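(* Let $(A,\cdot,*,\{\cdot,\cdot,\cdot\},\langle\cdot,\cdot,\cdot\rangle)$ be a post-Lie-Yamaguti algebra, with the derived operations $[\cdot,\cdot]_C$, $[\![\cdot,\cdot,\cdot]\!]_C$ given by $$[x,y]_C=x*y-y*x+x\cdot y,\qquad [\![x,y,z]\!]_C=\{x,y,z\}_D+\{x,y,z\}-\{y,x,z\}+\langle x,y,z\rangle .$$ Then: (i) the triple $A^c:=(A,[\cdot,\cdot]_C,[\![\cdot,\cdot,\cdot]\!]_C)$ is a Lie-Yamaguti algebra (called the sub-adjacent Lie-Yamaguti algebra); (ii) the pair $(L,\mathcal R)$ of linear maps $L:A\to\mathfrak{gl}(A)$, $\mathcal R:\otimes^2A\to\mathfrak{gl}(A)$ given by $L(x)z=x*z$, $\mathcal R(x,y)z=\{z,x,y\}$ for all $x,y,z\in A$, is an action of the sub-adjacent Lie-Yamaguti algebra $A^c$ on the Lie-Yamaguti algebra $(A,\cdot,\langle\cdot,\cdot,\cdot\rangle)$; (iii) the identity map $\mathrm{Id}:A\to A$ is a relative Rota-Baxter operator of weight $1$ from $(A,\cdot,\langle\cdot,\cdot,\cdot\rangle)$ to $(A,[\cdot,\cdot]_C,[\![\cdot,\cdot,\cdot]\!]_C)$ with respect to the action $(L,\mathcal R)$.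
   Context: All vector spaces are finite-dimensional over a field $\mathbb K$ of characteristic $0$. **Lie-Yamaguti algebra**: a vector space $\mathfrak g$ with a bilinear bracket $[\cdot,\cdot]:\wedge^2\mathfrak g\to\mathfrak g$ and a trilinear bracket $[\![\cdot,\cdot,\cdot]\!]:\wedge^2\mathfrak g\otimes\mathfrak g\to\mathfrak g$ (skew-symmetric in the first two arguments) such that for all $x,y,z,w,t$: $[[x,y],z]+[[y,z],x]+[[z,x],y]+[\![x,y,z]\!]+[\![y,z,x]\!]+[\![z,x,y]\!]=0$; $[\![[x,y],z,w]\!]+[\![[y,z],x,w]\!]+[\![[z,x],y,w]\!]=0$; $[\![x,y,[z,w]]\!]=[[\![x,y,z]\!],w]+[z,[\![x,y,w]\!]]$; $[\![x,y,[\![z,w,t]\!]]\!]=[\![[\![x,y,z]\!],w,t]\!]+[\![z,[\![x,y,w]\!],t]\!]+[\![z,w,[\![x,y,t]\!]]\!]$. **Representation** of $\mathfrak g$: a vector space $V$ with linear $\rho:\mathfrak g\to\mathfrak{gl}(V)$ and bilinear $\mu:\otimes^2\mathfrak g\to\mathfrak{gl}(V)$ such that for all $x,y,z,w\in\mathfrak g$: $\mu([x,y],z)-\mu(x,z)\rho(y)+\mu(y,z)\rho(x)=0$; $\mu(x,[y,z])-\rho(y)\mu(x,z)+\rho(z)\mu(x,y)=0$; $\rho([\![x,y,z]\!])=[D(x,y),\rho(z)]$; $\mu(z,w)\mu(x,y)-\mu(y,w)\mu(x,z)-\mu(x,[\![y,z,w]\!])+D(y,z)\mu(x,w)=0$;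 $\mu([\![x,y,z]\!],w)+\mu(z,[\![x,y,w]\!])=[D(x,y),\mu(z,w)]$; where $D(x,y)=D_{\rho,\mu}(x,y):=\mu(y,x)-\mu(x,y)+[\rho(x),\rho(y)]-\rho([x,y])$. **Center** of a Lie-Yamaguti algebra $\mathfrak h$: $C(\mathfrak h)=\{x\in\mathfrak h:[x,y]=0\ \forall y\in\mathfrak h\}\cap\big(\{x\in\mathfrak h:[\![x,y,z]\!]=0\ \forall y,z\in\mathfrak h\}\cup\{x\in\mathfrak h:[\![y,z,x]\!]=0\ \forall y,z\in\mathfrak h\}\big)$. **Action** of $\mathfrak g$ on a Lie-Yamaguti algebra $(\mathfrak h,[\cdot,\cdot]_{\mathfrak h},[\![\cdot,\cdot,\cdot]\!]_{\mathfrak h})$: a pair $(\rho,\mu)$ such that $(\mathfrak h;\rho,\mu)$ is a representation of $\mathfrak g$ and for all $x,y\in\mathfrak g$, $u,v,w\in\mathfrak h$: $\rho(x)u,\ \mu(x,y)u\in C(\mathfrak h)$; $\rho(x)[u,v]_{\mathfrak h}=\mu(x,y)[u,v]_{\mathfrak h}=0$; $\rho(x)[\![u,v,w]\!]_{\mathfrak h}=\mu(x,y)[\![u,v,w]\!]_{\mathfrak h}=0$. **Relative Rota-Baxter operator of weight $1$** from $\mathfrak h$ to $\mathfrak g$ with respect to an action $(\rho,\mu)$ of $\mathfrak g$ on $\mathfrak h$: a linear map $T:\mathfrak h\to\mathfrak g$ such that for all $u,v,w\in\mathfrak h$ $[Tu,Tv]_{\mathfrak g}=T(\rho(Tu)v-\rho(Tv)u+[u,v]_{\mathfrak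 h})$, $[\![Tu,Tv,Tw]\!]_{\mathfrak g}=T(D(Tu,Tv)w+\mu(Tv,Tw)u-\mu(Tu,Tw)v+[\![u,v,w]\!]_{\mathfrak h})$. **Post-Lie-Yamaguti algebra**: a vector space $A$ with operations $\cdot:\wedge^2A\to A$, $*:\otimes^2A\to A$, $\langle\cdot,\cdot,\cdot\rangle:\wedge^2A\otimes A\to A$, $\{\cdot,\cdot,\cdot\}:\otimes^3A\to A$ such that $(A,\cdot,\langle\cdot,\cdot,\cdot\rangle)$ is a Lie-Yamaguti algebra (with binary bracket $x\cdot y$ and ternary bracket $\langle x,y,z\rangle$) and, for all $x,y,z,w,t\in A$: $\{z,[x,y]_C,w\}=\{y*z,x,w\}-\{x*z,y,w\}$; $\{x,y,[z,w]_C\}=z*\{x,y,w\}-w*\{x,y,z\}$; $[\![x,y,z]\!]_C*w=\{x,y,z*w\}_D-z*\{x,y,w\}_D$; $\{x,y,[\![z,w,t]\!]_C\}=\{\{x,y,z\},w,t\}-\{\{x,y,w\},z,t\}+\{z,w,\{x,y,t\}\}_D$; $\{x,y,\{z,w,t\}\}_D=\{\{x,y,z\}_D,w,t\}+\{z,[\![x,y,w]\!]_C,t\}+\{z,w,[\![x,y,t]\!]_C\}$; $(x*y)\cdot z=\langle x*y,z,w\rangle=\langle z,w,x*y\rangle=0$; $x*(y\cdot z)=\{x\cdot y,z,w\}=0$; $x*\langle z,w,t\rangle=\{\langle z,w,t\rangle,x,y\}=0$; where $[x,y]_C=x*y-y*x+x\cdot y$, $[\![x,y,z]\!]_C=\{x,y,z\}_D+\{x,y,z\}-\{y,x,z\}+\langle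 x,y,z\rangle$, $\{x,y,z\}_D=\{z,y,x\}-\{z,x,y\}+(y,x,z)-(x,y,z)-(x\cdot y)*z$, and $(x,y,z)=(x*y)*z-x*(y*z)$.
   Formalization: The formal theorem additionally assumes {x,y,z}·w = ⟨{x,y,z},w,t⟩ = ⟨w,t,{x,y,z}⟩ = 0 for all x,y,z,w,t; without this, parts (i) and (ii) fail, e.g. for * = 0, ⟨,,⟩ = 0, {e,f,e} = b, b·c = −c·b = z. *)

(* Defs.v *)
From mathcomp Require Import all_boot all_algebra.

Set Implicit Arguments.
Unset Strict Implicit.
Unset Printing Implicit Defensive.

Import GRing.Theory.
Local Open Scope ring_scope.

Definition bilinear2 (K : fieldType) (U V W : lmodType K) (f : U -> V -> W) : Prop :=
  (forall u, linear (f u)) /\ (forall v, linear (fun u => f u v)).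

Definition trilinear3 (K : fieldType) (U V W X : lmodType K)
    (f : U -> V -> W -> X) : Prop :=
  [/\ forall u v, linear (f u v),
      forall u w, linear (fun v => f u v w)
    & forall v w, linear (fun u => f u v w)].

Definition end_comm (K : fieldType) (V : vectType K) (f g : 'End(V)) : 'End(V) :=
  (f \o g)%VF - (g \o f)%VF.

Record is_lie_yamaguti (K : fieldType) (g : vectType K)
    (br : g -> g -> g) (tr : g -> g -> g -> g) : Prop := IsLieYamaguti {
  ly_br_linear : bilinear2 br;
  ly_br_skew : forall x y, br x y = - br y x;
  ly_tr_linear : trilinear3 tr;
  ly_tr_skew : forall x y z, tr x y z = - tr y x z;
  ly_jacobi : forall x y z,
    br (br x y) z + br (br y z) x + br (br z x) y
      + tr x y z + tr y z x + tr z x y = 0;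
  ly_tr_br_cyclic : forall x y z w,
    tr (br x y) z w + tr (br y z) x w + tr (br z x) y w = 0;
  ly_tr_der_br : forall x y z w,
    tr x y (br z w) = br (tr x y z) w + br z (tr x y w);
  ly_tr_der_tr : forall x y z w t,
    tr x y (tr z w t)
      = tr (tr x y z) w t + tr z (tr x y w) t + tr z w (tr x y t)
}.

Definition rep_D (K : fieldType) (g V : vectType K) (br : g -> g -> g)
    (rho : g -> 'End(V)) (mu : g -> g -> 'End(V)) (x y : g) : 'End(V) :=
  mu y x - mu x y + end_comm (rho x) (rho y) - rho (br x y).

Record is_representation (K : fieldType) (g : vectType K)
    (br : g -> g -> g) (tr : g -> g -> g -> g) (V : vectType K)
    (rho : g -> 'End(V)) (mu : g -> g -> 'End(V)) : Prop := IsRepresentation {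
  rep_rho_linear : linear rho;
  rep_mu_linear : bilinear2 mu;
  rep_mu_brl : forall x y z,
    mu (br x y) z - (mu x z \o rho y)%VF + (mu y z \o rho x)%VF = 0;
  rep_mu_brr : forall x y z,
    mu x (br y z) - (rho y \o mu x z)%VF + (rho z \o mu x y)%VF = 0;
  rep_rho_tr : forall x y z,
    rho (tr x y z) = end_comm (rep_D br rho mu x y) (rho z);
  rep_mu_mu : forall x y z w,
    (mu z w \o mu x y)%VF - (mu y w \o mu x z)%VF - mu x (tr y z w)
      + (rep_D br rho mu y z \o mu x w)%VF = 0;
  rep_mu_der : forall x y z w,
    mu (tr x y z) w + mu z (tr x y w) = end_comm (rep_D br rho mu x y) (mu z w)
}.

Definition in_center (K : fieldType) (h : vectType K)
    (br : h -> h -> h) (tr : h -> h -> h -> h) (x : h) : Prop :=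
  (forall y, br x y = 0) /\
  ((forall y z, tr x y z = 0) \/ (forall y z, tr y z x = 0)).

Record is_action (K : fieldType) (g : vectType K)
    (brg : g -> g -> g) (trg : g -> g -> g -> g) (h : vectType K)
    (brh : h -> h -> h) (trh : h -> h -> h -> h)
    (rho : g -> 'End(h)) (mu : g -> g -> 'End(h)) : Prop := IsAction {
  act_rep : is_representation brg trg rho mu;
  act_rho_center : forall x u, in_center brh trh (rho x u);
  act_mu_center : forall x y u, in_center brh trh (mu x y u);
  act_rho_br : forall x u v, rho x (brh u v) = 0;
  act_mu_br : forall x y u v, mu x y (brh u v) = 0;
  act_rho_tr : forall x u v w, rho x (trh u v w) = 0;
  act_mu_tr : forall x y u v w, mu x y (trh u v w) = 0
}.

Definition is_rel_rota_baxter1 (K : fieldType) (g : vectType K)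
    (brg : g -> g -> g) (trg : g -> g -> g -> g) (h : vectType K)
    (brh : h -> h -> h) (trh : h -> h -> h -> h)
    (rho : g -> 'End(h)) (mu : g -> g -> 'End(h)) (T : 'Hom(h, g)) : Prop :=
  (forall u v,
    brg (T u) (T v) = T (rho (T u) v - rho (T v) u + brh u v)) /\
  (forall u v w,
    trg (T u) (T v) (T w)
      = T (rep_D brg rho mu (T u) (T v) w + mu (T v) (T w) u
           - mu (T u) (T w) v + trh u v w)).

(* The four operations of a post-Lie-Yamaguti algebra are written
   [dot x y] = x . y, [ast x y] = x * y, [angle x y z] = <x, y, z> and
   [brace x y z] = {x, y, z}. *)

Definition assoc_ast (K : fieldType) (A : vectType K) (ast : A -> A -> A)
    (x y z : A) : A :=
  ast (ast x y) z - ast x (ast y z).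

Definition sub_br (K : fieldType) (A : vectType K) (dot ast : A -> A -> A)
    (x y : A) : A :=
  ast x y - ast y x + dot x y.

Definition brace_D (K : fieldType) (A : vectType K) (dot ast : A -> A -> A)
    (brace : A -> A -> A -> A) (x y z : A) : A :=
  brace z y x - brace z x y + assoc_ast ast y x z - assoc_ast ast x y z
    - ast (dot x y) z.

Definition sub_tr (K : fieldType) (A : vectType K) (dot ast : A -> A -> A)
    (brace angle : A -> A -> A -> A) (x y z : A) : A :=
  brace_D dot ast brace x y z + brace x y z - brace y x z + angle x y z.

Record is_post_lie_yamaguti (K : fieldType) (A : vectType K)
    (dot ast : A -> A -> A) (brace angle : A -> A -> A -> A) : Prop :=
  IsPostLieYamaguti {
  ply_ly : is_lie_yamaguti dot angle;
  ply_ast_linear : bilinear2 ast;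
  ply_brace_linear : trilinear3 brace;
  ply_brace_brm : forall x y z w,
    brace z (sub_br dot ast x y) w = brace (ast y z) x w - brace (ast x z) y w;
  ply_brace_brr : forall x y z w,
    brace x y (sub_br dot ast z w) = ast z (brace x y w) - ast w (brace x y z);
  ply_tr_ast : forall x y z w,
    ast (sub_tr dot ast brace angle x y z) w
      = brace_D dot ast brace x y (ast z w) - ast z (brace_D dot ast brace x y w);
  ply_brace_trr : forall x y z w t,
    brace x y (sub_tr dot ast brace angle z w t)
      = brace (brace x y z) w t - brace (brace x y w) z t
        + brace_D dot ast brace z w (brace x y t);
  ply_D_brace : forall x y z w t,
    brace_D dot ast brace x y (brace z w t)
      = brace (brace_D dot ast brace x y z) w t
        + brace z (sub_tr dot ast brace angle x y w) t
        + brace z w (sub_tr dot ast brace angle x y t);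
  ply_ast_dot : forall x y z, dot (ast x y) z = 0;
  ply_ast_anglel : forall x y z w, angle (ast x y) z w = 0;
  ply_ast_angler : forall x y z w, angle z w (ast x y) = 0;
  ply_dot_ast : forall x y z, ast x (dot y z) = 0;
  ply_dot_brace : forall x y z w, brace (dot x y) z w = 0;
  ply_angle_ast : forall x z w t, ast x (angle z w t) = 0;
  ply_angle_brace : forall x y z w t, brace (angle z w t) x y = 0
}.

(* The analogue for {x, y, z} of the laws
   (x * y) . z = <x * y, z, w> = <z, w, x * y> = 0.  It does not follow from
   [is_post_lie_yamaguti], and without it the sub-adjacent operations need not
   form a Lie-Yamaguti algebra, nor do the {u, x, y} need to be central: on a
   space with basis e, f, b, c, z take ast = angle = 0 and let the only nonzero
   products of basis vectors be {e, f, e} = b and b . c = - c . b = z. *)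
Record brace_central (K : fieldType) (A : vectType K) (dot : A -> A -> A)
    (brace angle : A -> A -> A -> A) : Prop := BraceCentral {
  brace_dot : forall x y z w, dot (brace x y z) w = 0;
  brace_anglel : forall x y z w t, angle (brace x y z) w t = 0;
  brace_angler : forall x y z w t, angle w t (brace x y z) = 0
}.

(* For linear [f], [linfun f] is [f] as an element of 'End(A). *)
Definition left_mul (K : fieldType) (A : vectType K) (ast : A -> A -> A)
    (x : A) : 'End(A) :=
  linfun (ast x).

Definition right_mul (K : fieldType) (A : vectType K)
    (brace : A -> A -> A -> A) (x y : A) : 'End(A) :=
  linfun (fun z => brace z x y).

(* Main.v *)
Require Import Defs.
From HB Require Import structures.
From mathcomp Require Import all_boot all_algebra.
From mathcomp Require Import ring.

Set Implicit Arguments.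
Unset Strict Implicit.
Unset Printing Implicit Defensive.

Import GRing.Theory.
Local Open Scope ring_scope.

(** The axioms of a post-Lie-Yamaguti algebra are made so that the sub-adjacent
operations act on the original Lie-Yamaguti algebra.  With L(x) z = x * z and
R(x, y) z = {z, x, y}, the operator D(x, y) of the pair (L, R) is z |->
{x, y, z}_D ([rep_D_sub_adjacent]).  Read through this dictionary, the five
identities of a representation are the five axioms that involve the sub-adjacent
operations, and the remaining conditions of an action are the vanishing axioms
together with the centrality of the values of {-, -, -}.  Likewise the
Rota-Baxter identities for the identity map are the definitions of [x, y]_C and
[[x, y, z]]_C.

What needs a proof is that [-, -]_C and [[-, -, -]]_C form a Lie-Yamaguti
structure.  Each of these operations is a sum of a Lie-Yamaguti operation of A
(x . y or <x, y, z>) and of terms built from * and {-, -, -}.  The two families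
barely interact: values of * and of {-, -, -} are killed by the dot and the
angle operations, and values of the dot and of the angle are killed by L and R.
So every law splits into the same law for the dot and the angle, and an identity
between representation operators.  Two such identities are not axioms:

- D([x, y], z) + D([y, z], x) + D([z, x], y) = 0 ([brace_D_bracket_cyclic]).
  The terms [L([x, y]), L(z)] of this sum also occur in [D(x, y), L(z)], which is
  L([[x, y, z]]); there they come with [[L(x), L(y)], L(z)], whose cyclic sum
  vanishes.  The terms L([[x, y], z]) have cyclic sum opposite to that of
  L([[x, y, z]]), because the first law is already known.  The terms in R cancel
  by the axioms for R([x, y], z) and R(x, [y, z]).

- [D(x, y), D(z, w)] = D([[x, y, z]], w) + D(z, [[x, y, w]])
  ([brace_D_derivation]).  The operator D(z, w) is made of R(w, z), R(z, w),
  L(z), L(w) and L([z, w]); bracketing with D(x, y) differentiates the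
  arguments of each of them, and for the last one this uses that
  [[x, y, -]] is already known to be a derivation of [-, -]_C.

Hence the order of the proofs: the first law precedes the cyclic law for the
triple product, and the derivation law for [-, -]_C precedes the one for
[[-, -, -]]_C. *)

(** * Linear functions and linear identities *)

(** Lets the theory of bundled linear maps apply to the operations, which are
linear in each argument only by hypothesis. *)
Lemma linear_bundle (K : fieldType) (U V : lmodType K) (f : U -> V) :
  linear f -> {g : {linear U -> V} | g = f :> (U -> V)}.
Proof.
move=> lin_f; have isLin := GRing.isLinear.Build K U V _ f lin_f.
by exists (HB.pack_for {linear U -> V} f isLin).
Qed.

Lemma linear_add (K : fieldType) (U V : lmodType K) (f : U -> V) :
  linear f -> {morph f : u v / u + v}.
Proof. by move/linear_bundle=> [g <-]; exact: linearD. Qed.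

Lemma linear_opp (K : fieldType) (U V : lmodType K) (f : U -> V) :
  linear f -> {morph f : u / - u}.
Proof. by move/linear_bundle=> [g <-]; exact: linearN. Qed.

Lemma linear_scale (K : fieldType) (U V : lmodType K) (f : U -> V) :
  linear f -> forall a, {morph f : u / a *: u}.
Proof. by move/linear_bundle=> [g <-]; exact: linearZZ. Qed.

Lemma linfun_apply (K : fieldType) (U V : vectType K) (f : U -> V) :
  linear f -> linfun f =1 f.
Proof. by move/linear_bundle=> [g <-]; exact: lfunE. Qed.

Lemma end_commE (K : fieldType) (V : vectType K) (f g : 'End(V)) v :
  end_comm f g v = f (g v) - g (f v).
Proof. by rewrite /end_comm !lfun_simp. Qed.

Lemma eq_coord (K : fieldType) (V : vectType K) (u v : V) :
  (forall i, coord (vbasis {:V}) i u = coord (vbasis {:V}) i v) -> u = v.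
Proof.
move=> uv; rewrite (coord_vbasis (memvf u)) (coord_vbasis (memvf v)).
by apply: eq_bigr => i _; rewrite uv.
Qed.

Lemma coordE (K : fieldType) (V : vectType K) n (X : n.-tuple V) i :
  (coord X i 0 = 0) *
  (forall u v, coord X i (u + v) = coord X i u + coord X i v) *
  (forall u, coord X i (- u) = - coord X i u) *
  (forall a u, coord X i (a *: u) = a * coord X i u).
Proof.
do !split=> *; [exact: linear0|exact: linearD|exact: linearN|exact: linearZ].
Qed.

(** Proves a linear identity between vectors, up to the laws of a vector space:
on coordinates it becomes a polynomial identity over the ground field. *)
Ltac vect_ring := apply: eq_coord => ?; rewrite ?coordE; ring.

Section PostLieYamaguti.

Context (K : fieldType) (A : vectType K).
Context (dot ast : A -> A -> A) (brace angle : A -> A -> A -> A).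
Context (hA : is_post_lie_yamaguti dot ast brace angle).

Local Notation bracket := (sub_br dot ast).
Local Notation triple := (sub_tr dot ast brace angle).
Local Notation D := (brace_D dot ast brace).
Local Notation L := (left_mul ast).
Local Notation R := (right_mul brace).

Let hLY : is_lie_yamaguti dot angle := ply_ly hA.

(** * Rewriting rules for the four operations *)

Lemma ops_linear :
  (forall x, linear (dot x)) * (forall x, linear (dot^~ x)) *
  (forall x, linear (ast x)) * (forall x, linear (ast^~ x)) *
  (forall x y, linear (brace x y)) * (forall x y, linear ((brace x)^~ y)) *
  (forall x y, linear (fun z => brace z x y)) *
  (forall x y, linear (angle x y)) * (forall x y, linear ((angle x)^~ y)) *
  (forall x y, linear (fun z => angle z x y)).
Proof.
case: (ly_br_linear hLY) (ly_tr_linear hLY) => ? ? [? ? ?].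
by case: (ply_ast_linear hA) (ply_brace_linear hA) => ? ? [? ? ?].
Qed.

Lemma opsD :
  (forall x u v, dot x (u + v) = dot x u + dot x v) *
  (forall x u v, dot (u + v) x = dot u x + dot v x) *
  (forall x u v, ast x (u + v) = ast x u + ast x v) *
  (forall x u v, ast (u + v) x = ast u x + ast v x) *
  (forall x y u v, brace x y (u + v) = brace x y u + brace x y v) *
  (forall x y u v, brace x (u + v) y = brace x u y + brace x v y) *
  (forall x y u v, brace (u + v) x y = brace u x y + brace v x y) *
  (forall x y u v, angle x y (u + v) = angle x y u + angle x y v) *
  (forall x y u v, angle x (u + v) y = angle x u y + angle x v y) *
  (forall x y u v, angle (u + v) x y = angle u x y + angle v x y).
Proof.
case: ops_linear => [[[[[[[[[dr dl] ar] al] br] bm] bl] nr] nm] nl].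
exact: (fun x => linear_add (dr x), fun x => linear_add (dl x),
  fun x => linear_add (ar x), fun x => linear_add (al x),
  fun x y => linear_add (br x y), fun x y => linear_add (bm x y),
  fun x y => linear_add (bl x y), fun x y => linear_add (nr x y),
  fun x y => linear_add (nm x y), fun x y => linear_add (nl x y)).
Qed.

Lemma opsN :
  (forall x u, dot x (- u) = - dot x u) *
  (forall x u, dot (- u) x = - dot u x) *
  (forall x u, ast x (- u) = - ast x u) *
  (forall x u, ast (- u) x = - ast u x) *
  (forall x y u, brace x y (- u) = - brace x y u) *
  (forall x y u, brace x (- u) y = - brace x u y) *
  (forall x y u, brace (- u) x y = - brace u x y) *
  (forall x y u, angle x y (- u) = - angle x y u) *
  (forall x y u, angle x (- u) y = - angle x u y) *
  (forall x y u, angle (- u) x y = - angle u x y).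
Proof.
case: ops_linear => [[[[[[[[[dr dl] ar] al] br] bm] bl] nr] nm] nl].
exact: (fun x => linear_opp (dr x), fun x => linear_opp (dl x),
  fun x => linear_opp (ar x), fun x => linear_opp (al x),
  fun x y => linear_opp (br x y), fun x y => linear_opp (bm x y),
  fun x y => linear_opp (bl x y), fun x y => linear_opp (nr x y),
  fun x y => linear_opp (nm x y), fun x y => linear_opp (nl x y)).
Qed.

Lemma opsZ :
  (forall x a u, dot x (a *: u) = a *: dot x u) *
  (forall x a u, dot (a *: u) x = a *: dot u x) *
  (forall x a u, ast x (a *: u) = a *: ast x u) *
  (forall x a u, ast (a *: u) x = a *: ast u x) *
  (forall x y a u, brace x y (a *: u) = a *: brace x y u) *
  (forall x y a u, brace x (a *: u) y = a *: brace x u y) *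
  (forall x y a u, brace (a *: u) x y = a *: brace u x y) *
  (forall x y a u, angle x y (a *: u) = a *: angle x y u) *
  (forall x y a u, angle x (a *: u) y = a *: angle x u y) *
  (forall x y a u, angle (a *: u) x y = a *: angle u x y).
Proof.
case: ops_linear => [[[[[[[[[dr dl] ar] al] br] bm] bl] nr] nm] nl].
exact: (fun x => linear_scale (dr x), fun x => linear_scale (dl x),
  fun x => linear_scale (ar x), fun x => linear_scale (al x),
  fun x y => linear_scale (br x y), fun x y => linear_scale (bm x y),
  fun x y => linear_scale (bl x y), fun x y => linear_scale (nr x y),
  fun x y => linear_scale (nm x y), fun x y => linear_scale (nl x y)).
Qed.

Lemma ast0l x : ast 0 x = 0.
Proof. by rewrite -(scale0r 0) opsZ !scale0r. Qed.

Lemma ast0r x : ast x 0 = 0.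
Proof. by rewrite -(scale0r 0) opsZ !scale0r. Qed.

Lemma ops_annihilate :
  (forall x y z, dot (ast x y) z = 0) *
  (forall x y z w, angle (ast x y) z w = 0) *
  (forall x y z w, angle z w (ast x y) = 0) *
  (forall x y z, ast x (dot y z) = 0) *
  (forall x y z w, brace (dot x y) z w = 0) *
  (forall x z w t, ast x (angle z w t) = 0) *
  (forall x y z w t, brace (angle z w t) x y = 0).
Proof. by case: hA. Qed.

Lemma brace_bracketl x y z w :
  brace (bracket x y) z w = brace (ast x y) z w - brace (ast y x) z w.
Proof. by rewrite /sub_br !(opsD, opsN, ops_annihilate) addr0. Qed.

Lemma angle_bracketl x y z w : angle (bracket x y) z w = angle (dot x y) z w.
Proof. by rewrite /sub_br !(opsD, opsN, ops_annihilate) subrr add0r. Qed.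

Lemma angle_bracketr x y z w : angle z w (bracket x y) = angle z w (dot x y).
Proof. by rewrite /sub_br !(opsD, opsN, ops_annihilate) subrr add0r. Qed.

(** * The operators D(x, y) *)

(** The operator form D(x, y) = R(y, x) - R(x, y) + [L(x), L(y)] - L([x, y]). *)
Lemma brace_DE x y z :
  D x y z = brace z y x - brace z x y + (ast x (ast y z) - ast y (ast x z))
    - ast (bracket x y) z.
Proof. by rewrite /brace_D /assoc_ast /sub_br !(opsD, opsN); vect_ring. Qed.

Lemma brace_D_linear x y : linear (D x y).
Proof.
by move=> a u v; rewrite /brace_D /assoc_ast !(opsD, opsN, opsZ); vect_ring.
Qed.

Lemma brace_D_skew x y z : D x y z = - D y x z.
Proof.
by rewrite /brace_D /assoc_ast (ly_br_skew hLY x y) opsN; vect_ring.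
Qed.

Lemma brace_D_dot x y z w : D x y (dot z w) = 0.
Proof.
rewrite /brace_D /assoc_ast !(ply_dot_brace hA) !(ply_dot_ast hA) !ast0r.
by vect_ring.
Qed.

Lemma brace_D_angle x y z w t : D x y (angle z w t) = 0.
Proof.
rewrite /brace_D /assoc_ast !(ply_angle_brace hA) !(ply_angle_ast hA) !ast0r.
by vect_ring.
Qed.

(** * The action of the sub-adjacent algebra *)

Lemma left_mulE x z : L x z = ast x z.
Proof. by case: (ply_ast_linear hA) => lin _; rewrite (linfun_apply (lin x)). Qed.

Lemma right_mulE x y z : R x y z = brace z x y.
Proof.
by case: (ply_brace_linear hA) => _ _ lin; rewrite (linfun_apply (lin x y)).
Qed.

Lemma rep_D_sub_adjacent x y z : rep_D bracket L R x y z = D x y z.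
Proof.
by rewrite /rep_D /end_comm !lfun_simp !left_mulE !right_mulE brace_DE.
Qed.

Lemma sub_adjacent_representation : is_representation bracket triple L R.
Proof.
have repD := rep_D_sub_adjacent; have LE := left_mulE; have RE := right_mulE.
split.
- by move=> a x y; apply/lfunP=> z; rewrite !lfun_simp !LE !(opsD, opsZ).
- by split=> x a u v; apply/lfunP=> z; rewrite !lfun_simp !RE !(opsD, opsZ).
- move=> x y z; apply/lfunP=> w; rewrite !lfun_simp !LE !RE.
  by rewrite (ply_brace_brm hA); vect_ring.
- move=> x y z; apply/lfunP=> w; rewrite !lfun_simp !LE !RE.
  by rewrite (ply_brace_brr hA); vect_ring.
(* Replacing D by a variable keeps the rules that evaluate sums of operators
   from unfolding it. *)
- move: repD; move: (rep_D _ L R) => DR DE x y z; apply/lfunP=> w.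
  by rewrite end_commE !LE !DE (ply_tr_ast hA).
- move: repD; move: (rep_D _ L R) => DR DE x y z w; apply/lfunP=> v.
  by rewrite !lfun_simp !DE !RE (ply_brace_trr hA); vect_ring.
- move: repD; move: (rep_D _ L R) => DR DE x y z w; apply/lfunP=> v.
  by rewrite !lfun_simp !DE !RE (ply_D_brace hA); vect_ring.
Qed.

(** * Skew-symmetry and the two cyclic laws *)

Lemma bracket_linear : bilinear2 bracket.
Proof. by split=> u a v w; rewrite /sub_br !(opsD, opsZ); vect_ring. Qed.

Lemma triple_linear : trilinear3 triple.
Proof.
by split=> u v a x y; rewrite /sub_tr /brace_D /assoc_ast !(opsD, opsN, opsZ);
  vect_ring.
Qed.

Lemma bracket_skew x y : bracket x y = - bracket y x.
Proof. by rewrite /sub_br (ly_br_skew hLY x y); vect_ring. Qed.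

Lemma triple_skew x y z : triple x y z = - triple y x z.
Proof. by rewrite /sub_tr brace_D_skew (ly_tr_skew hLY x y); vect_ring. Qed.

(** The braces cancel in the cyclic sum of the triple products, and its terms
in * are those of the cyclic sum of [[x, y], z] with the opposite sign, so that
only the first law for the dot and the angle remains. *)
Lemma triple_jacobi x y z :
  bracket (bracket x y) z + bracket (bracket y z) x + bracket (bracket z x) y
    + triple x y z + triple y z x + triple z x y = 0.
Proof.
rewrite -[RHS](ly_jacobi hLY x y z) /sub_tr /brace_D /assoc_ast /sub_br.
by rewrite !(opsD, opsN, ops_annihilate); vect_ring.
Qed.

(** The operator part of the second law: adding L of the first law leaves
only terms in R(x, y) and L(z), which cancel by the axioms for R([x, y], z) and
R(x, [y, z]). *)
Lemma brace_D_bracket_cyclic x y z w :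
  D (bracket x y) z w + D (bracket y z) x w + D (bracket z x) y w = 0.
Proof.
(* A sum of variables: brackets and triple products are sums themselves, and
   have to stay folded here. *)
have ast_sum a b c d e f : ast (a + b + c + d + e + f) w =
    ast a w + ast b w + ast c w + ast d w + ast e w + ast f w.
  by rewrite !opsD.
(* L applied to the Jacobi law, with L([[x, y, z]]) = [D(x, y), L(z)]. *)
have := ast0l w; rewrite -{1}(triple_jacobi x y z) ast_sum !(ply_tr_ast hA).
move=> jacobi_ast; rewrite -[RHS]oppr0 -jacobi_ast.
rewrite 3!(brace_DE (bracket _ _)) !(ply_brace_brm hA) !(ply_brace_brr hA).
rewrite /brace_D /assoc_ast /sub_br !(opsD, opsN, ops_annihilate).
by vect_ring.
Qed.

Lemma triple_bracket_cyclic x y z w :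
  triple (bracket x y) z w + triple (bracket y z) x w
    + triple (bracket z x) y w = 0.
Proof.
rewrite /sub_tr !(ply_brace_brm hA) !brace_bracketl !angle_bracketl.
rewrite -[RHS]addr0 -{1}(ly_tr_br_cyclic hLY x y z w).
by rewrite -(brace_D_bracket_cyclic x y z w); vect_ring.
Qed.

(** The angle part of [[x, y, z]]_C is killed, since L vanishes on values of the
angle operation. *)
Lemma ast_triple x y z w :
  ast w (triple x y z)
    = ast w (D x y z) + ast w (brace x y z) - ast w (brace y x z).
Proof. by rewrite /sub_tr !(opsD, opsN) (ply_angle_ast hA) addr0. Qed.

Lemma brace_triple x y z w t :
  brace (triple x y z) w t
    = brace (D x y z) w t + brace (brace x y z) w t - brace (brace y x z) w t.
Proof. by rewrite /sub_tr !(opsD, opsN) (ply_angle_brace hA) addr0. Qed.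

(** * The two derivation laws *)

Context (hcentral : brace_central dot brace angle).

(** All terms of [[x, y, z]]_C but <x, y, z> are values of * or of {-, -, -}. *)
Lemma dot_triplel x y z w : dot (triple x y z) w = dot (angle x y z) w.
Proof.
rewrite /sub_tr /brace_D /assoc_ast !(opsD, opsN) !ops_annihilate.
by rewrite !(brace_dot hcentral); vect_ring.
Qed.

Lemma dot_tripler x y z w : dot w (triple x y z) = dot w (angle x y z).
Proof. by rewrite !(ly_br_skew hLY w) dot_triplel. Qed.

Lemma angle_triplel x y z w t :
  angle (triple x y z) w t = angle (angle x y z) w t.
Proof.
rewrite /sub_tr /brace_D /assoc_ast !(opsD, opsN) !ops_annihilate.
by rewrite !(brace_anglel hcentral); vect_ring.
Qed.

Lemma angle_triplem x y z w t :
  angle w (triple x y z) t = angle w (angle x y z) t.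
Proof. by rewrite !(ly_tr_skew hLY w) angle_triplel. Qed.

Lemma angle_tripler x y z w t :
  angle w t (triple x y z) = angle w t (angle x y z).
Proof.
rewrite /sub_tr /brace_D /assoc_ast !(opsD, opsN) !ops_annihilate.
by rewrite !(brace_angler hcentral); vect_ring.
Qed.

(** The three summands of [z, w]_C are handled separately: D(x, y) differentiates
the terms in *, by L([[x, y, z]]) = [D(x, y), L(z)]; the braces of
[[x, y, [z, w]]] are differences of L(z){x, y, w} and L(w){x, y, z}; the dot and
the angle satisfy the law themselves. *)
Lemma triple_der_bracket x y z w :
  triple x y (bracket z w) = bracket (triple x y z) w + bracket z (triple x y w).
Proof.
rewrite [bracket (triple _ _ _) _]/sub_br [bracket _ (triple _ _ _)]/sub_br.
rewrite !(ply_tr_ast hA) dot_triplel dot_tripler !ast_triple.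
have D_bracket : D x y (bracket z w) = D x y (ast z w) - D x y (ast w z).
  have lin := brace_D_linear x y.
  by rewrite /sub_br !(linear_add lin) (linear_opp lin) brace_D_dot addr0.
rewrite /sub_tr D_bracket !(ply_brace_brr hA) angle_bracketr.
by rewrite (ly_tr_der_br hLY); vect_ring.
Qed.

(** The operator part of the fourth law.  As [D(x, y), -] differentiates the
arguments of L and of R, it differentiates those of D; the term L([z, w]) of
D(z, w) needs the third law. *)
Lemma brace_D_derivation x y z w t :
  D x y (D z w t)
    = D (triple x y z) w t + D z (triple x y w) t + D z w (D x y t).
Proof.
have lin := brace_D_linear x y.
have D_ast u v : D x y (ast u v) = ast (triple x y u) v + ast u (D x y v).
  by rewrite (ply_tr_ast hA) subrK.
have ast_der_bracket : ast (bracket (triple x y z) w) t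
    + ast (bracket z (triple x y w)) t = ast (triple x y (bracket z w)) t.
  by rewrite triple_der_bracket opsD.
rewrite [D z w t]brace_DE !(linear_add lin) !(linear_opp lin).
rewrite !D_ast -ast_der_bracket.
rewrite !(ply_D_brace hA) [D _ w t]brace_DE [D z _ t]brace_DE [D z w _]brace_DE.
by rewrite !opsD; vect_ring.
Qed.

(** The terms of [[z, w, t]]_C in D and in the braces are differentiated by
D(x, y); the outer braces {x, y, -} - {y, x, -} supply the terms of
[[-, w, t]], [[z, -, t]] and [[z, w, -]] in which an inner brace occurs. *)
Lemma triple_der_triple x y z w t :
  triple x y (triple z w t)
    = triple (triple x y z) w t + triple z (triple x y w) t
      + triple z w (triple x y t).
Proof.
have trE u v s :
  triple u v s = D u v s + brace u v s - brace v u s + angle u v s by [].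
have D_sum u v p q r s :
    D u v (p + q - r + s) = D u v p + D u v q - D u v r + D u v s.
  have lin := brace_D_linear u v.
  by rewrite !(linear_add lin) (linear_opp lin).
have D_triple u v a b c : D u v (triple a b c) =
    D u v (D a b c) + D u v (brace a b c) - D u v (brace b a c).
  by rewrite [triple _ _ _]/sub_tr D_sum brace_D_angle addr0.
(* Only the outer products are expanded: the axioms speak of inner ones. *)
rewrite [triple x y (triple _ _ _)]trE [triple (triple _ _ _) _ _]trE.
rewrite [triple z (triple _ _ _) _]trE [triple z w (triple _ _ _)]trE.
rewrite !D_triple brace_D_derivation.
rewrite (ply_brace_trr hA x y z w t) (ply_brace_trr hA y x z w t).
rewrite (ply_D_brace hA x y z w t) (ply_D_brace hA x y w z t) !brace_triple.
rewrite angle_triplel angle_triplem !angle_tripler (ly_tr_der_tr hLY).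
by vect_ring.
Qed.

(** * Sub-adjacent algebra, action and Rota-Baxter operator *)

Lemma sub_adjacent_lie_yamaguti : is_lie_yamaguti bracket triple.
Proof.
split; first exact: bracket_linear.
- exact: bracket_skew.
- exact: triple_linear.
- exact: triple_skew.
- exact: triple_jacobi.
- exact: triple_bracket_cyclic.
- exact: triple_der_bracket.
- exact: triple_der_triple.
Qed.

Lemma sub_adjacent_action : is_action bracket triple dot angle L R.
Proof.
split; first exact: sub_adjacent_representation.
- move=> x u; rewrite left_mulE.
  by split=> [y|]; [|left=> y z]; rewrite ops_annihilate.
- move=> x y u; rewrite right_mulE; split=> [z|].
    exact: (brace_dot hcentral).
  by left=> z w; exact: (brace_anglel hcentral).
- by move=> *; rewrite left_mulE ops_annihilate.
- by move=> *; rewrite right_mulE ops_annihilate.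
- by move=> *; rewrite left_mulE ops_annihilate.
- by move=> *; rewrite right_mulE ops_annihilate.
Qed.

Lemma id_rel_rota_baxter1 :
  is_rel_rota_baxter1 bracket triple dot angle L R (\1%VF : 'Hom(A, A)).
Proof.
split=> [u v|u v w]; rewrite !id_lfunE ?left_mulE //.
by rewrite rep_D_sub_adjacent !right_mulE.
Qed.

End PostLieYamaguti.

Theorem theorem4p4 (K : fieldType) (charK : [pchar K] =i pred0)
    (A : vectType K) (dot ast : A -> A -> A) (brace angle : A -> A -> A -> A)
    (hA : is_post_lie_yamaguti dot ast brace angle)
    (hcentral : brace_central dot brace angle) :
  [/\ is_lie_yamaguti (sub_br dot ast) (sub_tr dot ast brace angle),
      is_action (sub_br dot ast) (sub_tr dot ast brace angle) dot angle
        (left_mul ast) (right_mul brace)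
    & is_rel_rota_baxter1 (sub_br dot ast) (sub_tr dot ast brace angle) dot angle
        (left_mul ast) (right_mul brace) (\1%VF : 'Hom(A, A))].
Proof.
split; first exact: sub_adjacent_lie_yamaguti.
- exact: sub_adjacent_action.
- exact: id_rel_rota_baxter1.
Qed.
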